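(* Let $\{r_n\}_{n=1}^\infty$ be a sequence of positive real numbers. If $r_n$ is bounded away from zero (i.e. $\inf_n r_n>0$), then $\{S^n(r_n)\}_{n=1}^\infty$ and $\{\mathbb{C}P^n(r_n)\}_{n=1}^\infty$ both have no $\square$-convergent subsequence.
   Context: An mm-space is a triple $(X,d_X,\mu_X)$ where $(X,d_X)$ is a complete separable metric space and $\mu_X$ is a Borel probability measure on $X$; it is always assumed that $X=\operatorname{supp}\mu_X$. Let $I=[0,1)$ with Lebesgue measure $\mathcal{L}^1$. A parameter of $X$ is a Borel map $\varphi:I\to X$ with $\varphi_*\mathcal{L}^1=\mu_X$. The box distance $\square(X,Y)$ between mm-spaces is the infimum of $\varepsilon\ge 0$ such that there are parameters $\varphi$ of $X$, $\psi$ of $Y$ and a Borel set $I_0\subset I$ with $\mathcal{L}^1(I_0)\ge 1-\varepsilon$ and $|d_X(\varphi(s),\varphi(t))-d_Y(\psi(s),\psi(t))|\le\varepsilon$ for all $s,t\in I_0$. A sequence $X_n$ is $\square$-convergent if $\square(X_n,X)\to0$ for some mm-space $X$. $S^n(r)=\{x\in\mathbb{R}^{n+1}\mid\|x\|_2=r\}$ is equipped with the normalized volume measure and with either the Riemannian (geodesic) distance or the restriction of the Euclidean distance. $\mathbb{C}P^n(r):=S^{2n+1}(r)/S^1$ is the quotient by the Hopf action $(e^{\sqrt{-1}t},z)\mapsto e^{\sqrt{-1}t}z$ on $\mathbb{C}^{n+1}=\mathbb{R}^{2n+2}$, with the quotient metric $d([x],[y])=\inf_{x'\in[x],y'\in[y]}d_{S^{2n+1}(r)}(x',y')$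 and the push-forward measure under the projection. The statement is for either choice of distance on the spheres (and the corresponding quotient distance). *)

(* Defs.v *)
From HB Require Import structures.
From mathcomp Require Import all_boot all_order all_algebra generic_quotient.
From mathcomp Require Import all_classical all_reals all_analysis.
From mathcomp Require Import ring.
Set Implicit Arguments.
Unset Strict Implicit.
Unset Printing Implicit Defensive.
Import Order.TTheory GRing.Theory Num.Theory.
Import numFieldNormedType.Exports.

Local Open Scope classical_set_scope.
Local Open Scope ring_scope.

(** * mm-spaces and the box distance *)

(* The data of an mm-space; the axioms are collected in [is_mm_space]. Only the
   values of [mass] on Borel sets are relevant. *)
Record mm_triple (R : realType) := MMTriple {
  carrier :> pointedType ;
  dist : carrier -> carrier -> R ;
  mass : set carrier -> \bar R }.

Section mm_space.
Context {R : realType}.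
Implicit Types X Y : mm_triple R.

Definition mball X (x : X) (e : R) : set X := [set y | dist x y < e].

Definition mopen X : set (set X) :=
  [set U | forall x, U x -> exists2 e : R, 0 < e & mball x e `<=` U].

Definition borel X := g_sigma_algebraType (@mopen X).

Definition is_metric X :=
  [/\ forall x y : X, dist x y = 0 <-> x = y,
      forall x y : X, dist x y = dist y x &
      forall x y z : X, dist x z <= dist x y + dist y z].

Definition is_complete X := forall u : nat -> X,
  (forall e : R, 0 < e -> exists N : nat, forall m n : nat,
     (N <= m)%N -> (N <= n)%N -> dist (u m) (u n) < e) ->
  exists l : X, dist (u n) l @[n --> \oo] --> 0.

Definition is_separable X := exists2 D : set X, countable D &
  forall (x : X) (e : R), 0 < e -> (D `&` mball x e) !=set0.

Definition is_borel_probability X := exists P : probability (borel X) R,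
  forall A : set (borel X), measurable A -> mass A = P A.

Definition msupport X : set X :=
  [set x | forall e : R, 0 < e -> (0 < mass (mball x e))%E].

Definition is_mm_space X :=
  [/\ is_metric X, is_complete X, is_separable X, is_borel_probability X &
      @msupport X = setT].

(* The values of a parameter outside of [0, 1) are irrelevant. *)
Definition is_parameter X (phi : R -> X) :=
  measurable_fun (`[0, 1[ : set R) (phi : R -> borel X) /\
  forall A : set (borel X), measurable A ->
    lebesgue_measure (`[0, 1[ `&` phi @^-1` A) = mass A.

Definition box_le X Y (e : R) :=
  exists (phi : R -> X) (psi : R -> Y) (I0 : set R),
    [/\ is_parameter phi, is_parameter psi,
        measurable I0 /\ I0 `<=` `[0, 1[,
        ((1 - e)%:E <= lebesgue_measure I0)%E &
        forall s t : R, I0 s -> I0 t ->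
          `|dist (phi s) (phi t) - dist (psi s) (psi t)| <= e].

Definition box X Y : \bar R :=
  ereal_inf [set e%:E | e in [set e : R | 0 <= e /\ box_le X Y e]].

Definition box_convergent (X : nat -> mm_triple R) :=
  exists2 Y : mm_triple R, is_mm_space Y & box (X n) Y @[n --> \oo] --> 0%E.

Definition has_box_convergent_subsequence (X : nat -> mm_triple R) :=
  exists2 k : nat -> nat, {homo k : i j / (i < j)%N} &
    box_convergent (X \o k).

End mm_space.

(** * Hausdorff measure *)

Section hausdorff.
Context {R : realType} {T : Type} (d : T -> T -> R).
Local Open Scope ereal_scope.

(* The point 0 is added so that the empty set has diameter 0. *)
Definition diam (U : set T) : \bar R :=
  ereal_sup (0 |` [set (d x y)%:E | x in U & y in U]).

Definition hausdorff_pre (n : nat) (delta : R) (A : set T) : \bar R :=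
  ereal_inf [set \sum_(0 <= i <oo) diam (U i) ^+ n |
    U in [set U : nat -> set T |
      A `<=` \bigcup_i U i /\ forall i, diam (U i) <= delta%:E]].

(* Unnormalized: no factor for the volume of the unit ball. Meant for n > 0. *)
Definition hausdorff (n : nat) (A : set T) : \bar R :=
  ereal_sup [set hausdorff_pre n delta A | delta in [set delta | (0 < delta)%R]].

End hausdorff.

(** * Spheres *)

Section sphere.
Context {R : realType}.

Definition dot m (x y : 'rV[R]_m) : R := \sum_i x 0 i * y 0 i.

Definition norm2 m (x : 'rV[R]_m) : R := Num.sqrt (dot x x).

Definition sphere (n : nat) (r : {posnum R}) :=
  {x : 'rV[R]_n.+1 | norm2 x == r%:num}.

HB.instance Definition _ n r := Choice.on (sphere n r).

Lemma norm2_delta n (r : {posnum R}) :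
  norm2 (r%:num *: delta_mx 0 0 : 'rV[R]_n.+1) == r%:num.
Proof.
rewrite /norm2 /dot big_ord_recl big1 => [|i _].
  by rewrite !mxE eqxx mulr1 addr0 -expr2 sqrtr_sqr gtr0_norm.
by rewrite !mxE /= mulr0 mul0r.
Qed.

Definition sphere_pt n (r : {posnum R}) : sphere n r :=
  exist _ (r%:num *: delta_mx 0 0) (norm2_delta n r).

HB.instance Definition _ n r := isPointed.Build (sphere n r) (sphere_pt n r).

Definition euclidean_dist n r (x y : sphere n r) : R := norm2 (val x - val y).

(* The length of the shorter great-circle arc joining x and y. *)
Definition geodesic_dist n r (x y : sphere n r) : R :=
  r%:num * acos (dot (val x) (val y) / r%:num ^+ 2).

Variant sphere_distance := Riemannian | Euclidean.

Definition sphere_dist (c : sphere_distance) n r : sphere n r -> sphere n r -> R :=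
  match c with
  | Riemannian => @geodesic_dist n r
  | Euclidean => @euclidean_dist n r
  end.

(* The Riemannian volume measure of an n-dimensional Riemannian manifold is, up
   to a factor depending only on n, the n-dimensional Hausdorff measure of its
   Riemannian distance; the factor cancels in the normalization. *)
Definition sphere_volume n r (A : set (sphere n r)) : \bar R :=
  hausdorff (@geodesic_dist n r) n A.

Definition sphere_mass n r (A : set (sphere n r)) : \bar R :=
  (sphere_volume A * ((fine (@sphere_volume n r setT))^-1)%:E)%E.

Definition sphere_mm (c : sphere_distance) n r : mm_triple R :=
  @MMTriple R (sphere n r) (@sphere_dist c n r) (@sphere_mass n r).

End sphere.

(** * Complex projective spaces *)

Section projective.
Context {R : realType}.

(* C^m is identified with R^(m + m), the two blocks being the real and the
   imaginary parts of the coordinates; [hopf t x] is e^(it) x. *)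
Definition hopf m (t : R) (x : 'rV[R]_(m + m)) : 'rV[R]_(m + m) :=
  row_mx (cos t *: lsubmx x - sin t *: rsubmx x)
         (sin t *: lsubmx x + cos t *: rsubmx x).

(* S^(2n+1); the dimension is written n + n.+1 so that the ambient space
   'rV_(n + n.+1).+1 is convertible to 'rV_(n.+1 + n.+1). *)
Notation hopf_sphere n r := (sphere (n + n.+1) r).

Definition hopf_equiv n r (x y : hopf_sphere n r) : bool :=
  `[< exists t : R, val y = @hopf n.+1 t (val x) >].

Lemma hopf0 m (x : 'rV[R]_(m + m)) : hopf 0 x = x.
Proof. by rewrite /hopf cos0 sin0 !scale1r !scale0r subr0 add0r hsubmxK. Qed.

Lemma hopfD m s t (x : 'rV[R]_(m + m)) : hopf s (hopf t x) = hopf (s + t) x.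
Proof.
rewrite /hopf row_mxKl row_mxKr cosD sinD.
by congr row_mx; apply/rowP => i; rewrite !mxE; ring.
Qed.

Lemma hopf_equiv_refl n r : reflexive (@hopf_equiv n r).
Proof. by move=> x; apply/asboolP; exists 0; rewrite hopf0. Qed.

Lemma hopf_equiv_sym n r : symmetric (@hopf_equiv n r).
Proof.
suff H x y : @hopf_equiv n r x y -> hopf_equiv y x by move=> x y; apply/idP/idP; exact: H.
move=> /asboolP[t yx]; apply/asboolP; exists (- t).
by rewrite yx hopfD addNr hopf0.
Qed.

Lemma hopf_equiv_trans n r : transitive (@hopf_equiv n r).
Proof.
move=> y x z /asboolP[s yx] /asboolP[t zy]; apply/asboolP; exists (t + s).
by rewrite zy yx hopfD.
Qed.

Canonical hopf_equivRel n r := EquivRel (@hopf_equiv n r)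
  (@hopf_equiv_refl n r) (@hopf_equiv_sym n r) (@hopf_equiv_trans n r).

Definition cproj n (r : {posnum R}) := {eq_quot (hopf_equivRel n r)}%qT.
HB.instance Definition _ n r := Choice.on (cproj n r).

Definition hopf_proj n r (x : hopf_sphere n r) : cproj n r :=
  (\pi_({eq_quot (hopf_equivRel n r)}) x)%qT.

HB.instance Definition _ n r := isPointed.Build (cproj n r) (hopf_proj point).

Definition cproj_dist (c : sphere_distance) n r (a b : cproj n r) : R :=
  inf [set sphere_dist c x y | x in @hopf_proj n r @^-1` [set a]
                             & y in @hopf_proj n r @^-1` [set b]].

Definition cproj_mass n r (A : set (cproj n r)) : \bar R :=
  sphere_mass (@hopf_proj n r @^-1` A).

Definition cproj_mm (c : sphere_distance) n r : mm_triple R :=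
  @MMTriple R (cproj n r) (@cproj_dist c n r) (@cproj_mass n r).

End projective.

(* Main.v *)
Require Import Defs.
From mathcomp Require Import all_boot all_order all_algebra generic_quotient.
From mathcomp Require Import all_classical all_reals all_analysis.
From mathcomp Require Import ring lra.
Set Implicit Arguments.
Unset Strict Implicit.
Unset Printing Implicit Defensive.
Import Order.TTheory GRing.Theory Num.Theory.
Import numFieldNormedType.Exports.
Local Open Scope classical_set_scope.
Local Open Scope ring_scope.

(** A box limit [Y] would have a ball of some positive mass [p], because its
    measure has full support.  Two parameters that are almost isometric on a
    large set carry this ball to a ball of slightly larger radius and of mass at
    least [p - e] in every space [X_n] at box distance [e] from [Y]
    ([mball_mass_le]).  Hence it suffices that, for one fixed radius, the largest
    mass of a ball in [X_n] tends to 0 ([no_box_convergent_subsequence]).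

    This follows from symmetry alone.  The balls of radius [r / 2] around pairwise
    orthogonal points of a sphere of radius [r] are disjoint, since such points
    have distance [sqrt 2 * r], and they all have the same mass, since reflections
    act transitively on the sphere and preserve the volume.  There are at least
    [n + 1] such points, so each ball has mass at most [1 / (n + 1)].  The same
    works in complex projective space with the classes of the standard complex
    basis and with unitary reflections, which commute with the Hopf action.  Both
    cases are instances of one statement about images of spheres with homogeneous
    fibres ([small_ball]); as [inf r > 0], one radius serves for all [n].

    The mass is a normalized Hausdorff measure.  Its additivity on Borel sets
    comes from the parameter, through which the mass of a Borel set is the
    Lebesgue measure of its preimage; its invariance comes from the fact that
    Hausdorff measure does not increase under preimages by isometries
    ([hausdorff_le]).  The geodesic distance is at least the chordal one
    ([norm2_le_sphere_dist]), so that geodesic balls can be enlarged to chordal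
    balls, for which the triangle inequality is that of the norm. *)

(** * Dot product and reflections *)

Section dot_product.
Context {R : realType} {m : nat}.
Implicit Types (x y z w : 'rV[R]_m) (a : R).

Lemma dotC x y : dot x y = dot y x.
Proof. by apply: eq_bigr => i _; rewrite mulrC. Qed.

Lemma dotDl x y z : dot (x + y) z = dot x z + dot y z.
Proof. by rewrite /dot -big_split; apply: eq_bigr => i _; rewrite !mxE mulrDl. Qed.

Lemma dotZl a x y : dot (a *: x) y = a * dot x y.
Proof. by rewrite /dot mulr_sumr; apply: eq_bigr => i _; rewrite !mxE mulrA. Qed.

Lemma dotDr x y z : dot z (x + y) = dot z x + dot z y.
Proof. by rewrite dotC dotDl !(dotC z). Qed.

Lemma dotZr a x y : dot y (a *: x) = a * dot y x.
Proof. by rewrite dotC dotZl (dotC y). Qed.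

Lemma dotNl x y : dot (- x) y = - dot x y.
Proof. by rewrite -scaleN1r dotZl mulN1r. Qed.

Lemma dotNr x y : dot y (- x) = - dot y x.
Proof. by rewrite dotC dotNl (dotC y). Qed.

Definition dotE := (dotDl, dotDr, dotNl, dotNr, dotZl, dotZr).

Lemma dot_ge0 x : 0 <= dot x x.
Proof. by apply: sumr_ge0 => i _; rewrite -expr2 sqr_ge0. Qed.

Lemma dot_eq0 x : dot x x = 0 -> x = 0.
Proof.
move=> /eqP; rewrite psumr_eq0; last by move=> i _; rewrite -expr2 sqr_ge0.
move=> /allP x0; apply/rowP => i; rewrite mxE.
by have := x0 i (mem_index_enum i); rewrite /= mulf_eq0 orbb => /eqP.
Qed.

Lemma sqr_norm2 x : norm2 x ^+ 2 = dot x x.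
Proof. by rewrite sqr_sqrtr // dot_ge0. Qed.

Lemma norm2_ge0 x : 0 <= norm2 x.
Proof. exact: sqrtr_ge0. Qed.

(** Cauchy-Schwarz: expand the square of [|y|^2 x - <x, y> y]. *)
Lemma dot_le_norm2M x y : `|dot x y| <= norm2 x * norm2 y.
Proof.
rewrite -ler_sqr ?nnegrE ?mulr_ge0 ?norm2_ge0 // real_normK ?num_real //.
rewrite exprMn !sqr_norm2.
have [y0|y_neq0] := eqVneq (dot y y) 0.
  by rewrite (dot_eq0 y0) -(scale0r y) !dotZr !mul0r mulr0 expr0n.
have y_gt0 : 0 < dot y y by rewrite lt_def y_neq0 dot_ge0.
have := dot_ge0 (dot y y *: x - dot x y *: y).
rewrite !dotE (dotC y x) => H.
rewrite -subr_ge0 -(pmulr_rge0 _ y_gt0); move: H; congr (0 <= _); ring.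
Qed.

Lemma norm2D x y : norm2 (x + y) <= norm2 x + norm2 y.
Proof.
rewrite -ler_sqr ?nnegrE ?addr_ge0 ?norm2_ge0 // sqrrD !sqr_norm2 !dotE (dotC y x).
by have := dot_le_norm2M x y; have := ler_norm (dot x y); lra.
Qed.

Lemma norm2_sym x y : norm2 (x - y) = norm2 (y - x).
Proof. by rewrite /norm2; congr Num.sqrt; rewrite !dotE (dotC x y); ring. Qed.

Lemma norm2_triangle y x z : norm2 (x - z) <= norm2 (x - y) + norm2 (y - z).
Proof. by rewrite -[x - z](subrKA y) norm2D. Qed.

(** The reflection in the hyperplane orthogonal to [w]; as [0^-1 = 0], it is the
    identity for [w = 0]. *)
Definition reflection w x := x - (2 / dot w w * dot x w) *: w.

Lemma dot_reflection w x y : dot (reflection w x) (reflection w y) = dot x y.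
Proof.
rewrite /reflection; have [w0|w_neq0] := eqVneq (dot w w) 0.
  by rewrite w0 invr0 mulr0 !mul0r !scale0r !subr0.
by rewrite !dotE (dotC w y); field.
Qed.

Lemma reflectionN w : reflection (- w) = reflection w.
Proof.
by apply/funext => x; rewrite /reflection !dotE opprK scalerN !mulrN scaleNr opprK.
Qed.

Lemma reflection_orthogonal w x : dot x w = 0 -> reflection w x = x.
Proof. by rewrite /reflection => ->; rewrite mulr0 scale0r subr0. Qed.

(** The hyperplane orthogonal to [x - y] bisects two vectors of equal length. *)
Lemma reflection_swap x y : dot x x = dot y y -> reflection (x - y) x = y.
Proof.
move=> xy; rewrite /reflection.
have [w0|w_neq0] := eqVneq (dot (x - y) (x - y)) 0.
  by rewrite (dot_eq0 w0) scaler0 subr0; apply/eqP; rewrite -subr_eq0 (dot_eq0 w0).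
suff -> : 2 / dot (x - y) (x - y) * dot x (x - y) = 1 by rewrite scale1r subKr.
have E : dot (x - y) (x - y) = 2 * dot x (x - y).
  by rewrite !dotE (dotC y x) -xy; ring.
by rewrite mulrAC -E divff.
Qed.

Lemma reflectionC v w x : dot v w = 0 ->
  reflection v (reflection w x) = reflection w (reflection v x).
Proof.
move=> vw; rewrite /reflection !dotE (dotC w v) vw !mulr0 !subr0.
by rewrite addrAC.
Qed.

End dot_product.

(** * Chords and arcs *)

Lemma sin_le_id {R : realType} (x : R) : 0 <= x -> sin x <= x.
Proof.
move=> x0; have [|c _] := @MVT_segment R sin cos 0 x x0.
  exact/continuous_subspaceT/continuous_sin.
by rewrite sin0 !subr0 => ->; rewrite ler_piMl// cos_le1.
Qed.

(** From the half-angle formula [cos t = 1 - 2 sin(t/2)^2].  It says that a chord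
    is not longer than its arc. *)
Lemma cos_ge_quadratic {R : realType} (t : R) :
  0 <= t <= pi -> 1 - t ^+ 2 / 2 <= cos t.
Proof.
move=> /andP[t0 tpi].
have -> : cos t = 1 - 2 * sin (t / 2) ^+ 2.
  have {1}-> : t = (t / 2) *+ 2 by rewrite -mulr_natr; field.
  by rewrite cos_mulr2n cos2sin2 -mulr_natr; ring.
have s0 : 0 <= sin (t / 2) by apply: sin_ge0_pi; lra.
have s1 : sin (t / 2) <= t / 2 by apply: sin_le_id; lra.
have : sin (t / 2) ^+ 2 <= (t / 2) ^+ 2 by rewrite ler_sqr ?nnegrE //; lra.
by lra.
Qed.

(** * Hausdorff measure and isometries *)

Section hausdorff_comparison.
Context {R : realType} {T T' : Type}.
Variables (d : T -> T -> R) (d' : T' -> T' -> R) (f : T -> T').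
Hypothesis d'f : forall x y, d' (f x) (f y) = d x y.
Local Open Scope ereal_scope.

Lemma diam_ge0 (U : set T) : 0 <= diam d U.
Proof. by apply: ereal_sup_ubound; left. Qed.

Lemma diam_preimage_le (U : set T') : diam d (f @^-1` U) <= diam d' U.
Proof.
apply: ereal_sup_le => _ [->|[x Ux] [y Uy] <-]; first by left.
by right; exists (f x) => //; exists (f y) => //; rewrite d'f.
Qed.

(** A cover of [A] pulls back to a cover of [B] by sets that are no wider.  For
    a transitive family of isometries, applying this in both directions gives the
    invariance of the measure. *)
Lemma hausdorff_le n (B : set T) (A : set T') :
  B `<=` f @^-1` A -> hausdorff d n B <= hausdorff d' n A.
Proof.
move=> BA; apply: ge_ereal_sup => _ [delta delta0 <-].
apply: le_ereal_sup_tmp; exists (hausdorff_pre d' n delta A); first by exists delta.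
apply: le_ereal_inf_tmp => _ [U [AU Udelta] <-].
apply: ge_ereal_inf; exists (\sum_(0 <= i <oo) diam d (f @^-1` U i) ^+ n).
  exists (fun i => f @^-1` U i) => //; split=> [x /BA /AU|i].
    by rewrite -preimage_bigcup.
  exact: le_trans (diam_preimage_le _) (Udelta i).
apply: lee_nneseries => i _; first by rewrite expe_ge0 // diam_ge0.
elim: n => [|n IHn]; first by rewrite !expe0.
by rewrite !expeS lee_pmul // ?expe_ge0 // ?diam_ge0 // diam_preimage_le.
Qed.

End hausdorff_comparison.

(** * Balls in box limits *)

Section box_limit.
Context {R : realType}.
Implicit Types X Y : mm_triple R.

Lemma lebesgue_measure_unit_itv :
  lebesgue_measure (`[0%R, 1%R[ : set R) = 1%E.
Proof. by rewrite lebesgue_measure_itv /= lte01 oppr0 adde0. Qed.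

Lemma mball_mopen X (x : X) (e : R) : is_metric X -> mopen (mball x e).
Proof.
move=> [_ _ tri] y /= xy; exists (e - dist x y); first by rewrite subr_gt0.
by move=> z /= yz; apply: le_lt_trans (tri x y z) _; rewrite -ltrBrDl.
Qed.

Lemma measurable_mopen X (U : set (borel X)) : @mopen R X U -> measurable U.
Proof. by move=> oU; exact: sub_gen_smallest. Qed.

Lemma measurable_parameter X (phi : R -> X) (U : set (borel X)) :
  is_parameter phi -> measurable U ->
  measurable (`[0, 1[ `&` phi @^-1` U : set R).
Proof. by move=> [mphi _] mU; exact: mphi. Qed.

(** On the part of [I0] that [psi] sends to the ball around [y], the distances in
    [Y] are less than [2 * eta], so those in [X] are less than [2 * eta + e]: [phi]
    sends this part to a ball around any of its values.  The complement of [I0]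
    costs the term [e].  The ball of [X] is enlarged to a Borel set [U], since
    without the triangle inequality in [X] the ball itself may fail to be Borel. *)
Lemma mball_mass_le X Y (e eta : R) (y : Y) : is_metric Y -> box_le X Y e ->
  exists (phi : R -> X) (x : X), is_parameter phi /\
    forall U : set (borel X), measurable U -> mball x (eta *+ 2 + e) `<=` U ->
    (mass (mball y eta : set (borel Y)) <= mass U + e%:E)%E.
Proof.
move=> metY [phi [psi [I0 [phiP psiP [mI0 I0I] I0e close]]]].
have [_ symY triY] := metY.
have mB : measurable (mball y eta : set (borel Y)).
  by apply: measurable_mopen; exact: mball_mopen.
pose B' := `[0, 1[ `&` psi @^-1` mball y eta.
have mB' : measurable B' by exact: measurable_parameter.
have [x xP] : exists x : X, forall s, I0 s -> B' s -> dist x (phi s) < eta *+ 2 + e.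
  have [[s [Is Bs]]|ne] := pselect (exists s, I0 s /\ B' s); last first.
    (* the part is empty: any point of [X] will do *)
    by exists point => s Is Bs; exfalso; apply: ne; exists s.
  exists (phi s) => t It Bt.
  have := close _ _ Is It; rewrite ler_distl => /andP[_ close'].
  have st : dist (psi s) (psi t) < eta *+ 2.
    apply: le_lt_trans (triY _ y _) _.
    by rewrite mulr2n ltrD //; [rewrite symY; case: Bs|case: Bt].
  by apply: le_lt_trans close' _; rewrite ltrD2r.
exists phi, x; split=> // U mU xU.
rewrite -psiP.2 // -phiP.2 // -/B'.
set U' := _ `&` _; have mU' : measurable U' by exact: measurable_parameter.
have mI : measurable (`[0, 1[ : set R) by [].
have BU : B' `<=` U' `|` (`[0, 1[ `\` I0).
  move=> s Bs; have [Is|nIs] := pselect (I0 s); last by right; split=> //; case: Bs.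
  by left; split; [case: Bs|apply/xU/xP].
apply: (@le_trans _ _ (lebesgue_measure (U' `|` (`[0, 1[ `\` I0)))).
  apply: le_measure; rewrite ?inE //.
  by apply: measurableU => //; exact: measurableD.
apply: le_trans (measureU2 _ _ _) _ => //; first exact: measurableD.
have I1 := lebesgue_measure_unit_itv.
apply: leeD2l.
have I01 : (lebesgue_measure (`[0%R, 1%R[ `\` I0) + lebesgue_measure I0 = 1)%E.
  by rewrite -I1 [RHS](measureDI lebesgue_measure mI mI0) setIidr.
have Ifin : lebesgue_measure I0 \is a fin_num.
  by rewrite ge0_fin_numE // (@le_lt_trans _ _ 1%E) ?ltry // -I01 leeDr.
rewrite -(leeD2rE _ _ Ifin) I01.
by move: I0e; rewrite EFinB leeBlDr // addeC.
Qed.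

(** A ball of radius [e / 4] in the limit has positive mass [p] by full support.
    If the box distance is less than [p / 2] and [e / 2], [mball_mass_le] gives a
    ball of radius [2 * (e / 4) + e / 2 = e] and mass more than [p / 2], which is
    impossible once [1 / (n + 1) < p / 2]. *)
Lemma no_box_convergent_subsequence (X : nat -> mm_triple R) (e : R) : 0 < e ->
  (forall n (phi : R -> X n), is_parameter phi -> forall x : X n,
    exists U : set (borel (X n)),
      [/\ measurable U, mball x e `<=` U & (mass U <= (n.+1%:R^-1)%:E)%E]) ->
  ~ has_box_convergent_subsequence X.
Proof.
move=> e0 small [k k_incr [Y [metY _ _ [P PE] suppY] XY]].
have mB : measurable (mball point (e / 4) : set (borel Y)).
  by apply: measurable_mopen; exact: mball_mopen.
set B := mball _ _ in mB.
have [p p0 pB] : exists2 p : R, 0 < p & (p%:E <= mass B)%E.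
  exists (fine (mass B)).
    apply: fine_gt0; apply/andP; split.
      have : msupport (point : Y) by rewrite suppY.
      by apply; rewrite divr_gt0.
    by rewrite PE // (le_lt_trans (probability_le1 _ _)) ?ltry.
  by rewrite PE // fineK // fin_num_measure.
have q0 : 0 < Num.min (p / 2) (e / 2) by rewrite lt_min !divr_gt0.
have /fine_cvgP[boxfin /(cvgr_lt 0) /(_ _ q0) boxlt] := XY.
have nlarge := near_infty_natSinv_lt (PosNum (divr_gt0 p0 (ltr0n R 2))).
have [n [fn ln an]] : exists n, [/\ box ((X \o k) n) Y \is a fin_num,
    fine (box ((X \o k) n) Y) < Num.min (p / 2) (e / 2) & n.+1%:R^-1 < p / 2].
  near \oo => n; exists n; split; near: n.
  - exact: boxfin.
  - exact: boxlt.
  - exact: nlarge.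
have : (box (X (k n)) Y < (Num.min (p / 2) (e / 2))%:E)%E.
  by rewrite -(fineK fn) lte_fin.
move=> /ereal_inf_lt[_ [b [b0 XYb] <-]]; rewrite lte_fin lt_min => /andP[bp be].
have [phi [x [phiP xP]]] := mball_mass_le (e / 4) point metY XYb.
have [U [mU xU Un]] := small _ _ phiP x.
have : (mass B <= mass U + b%:E)%E.
  apply: xP => // z xz; apply: xU; apply: lt_le_trans xz _.
  by rewrite -mulr_natr; lra.
move=> /(le_trans pB) /le_trans /(_ (leeD2r b%:E Un)); rewrite -EFinD lee_fin.
have kn : (n <= k n)%N.
  elim: n {fn ln an b0 XYb b bp be phi x phiP xP U mU xU Un} => // n IHn.
  exact: leq_ltn_trans IHn (k_incr _ _ (ltnSn n)).
have : (k n).+1%:R^-1 <= n.+1%:R^-1 :> R by rewrite lef_pV2 ?posrE ?ltr0n // ler_nat.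
move=> le1 le2; have := ltrD (le_lt_trans le1 an) bp.
by rewrite -splitr ltNge le2.
Unshelve. all: by end_near.
Qed.

End box_limit.

(** * Balls in homogeneous images of spheres *)

Lemma dot_sphere {R : realType} n (r : {posnum R}) (x : sphere n r) :
  dot (val x) (val x) = r%:num ^+ 2.
Proof. by rewrite -sqr_norm2 (eqP (valP x)). Qed.

Section quotient_of_sphere.
Context {R : realType} {m : nat} {r : {posnum R}}.
Variables (X : mm_triple R) (p : sphere m r -> X).

(** What the identity of the sphere and the Hopf projection have in common.  The
    condition on distances is the only link between [dist] and the norm, and holds
    for both choices of the distance on the sphere; [projection_lift] follows for
    fibres that are the orbits of a group of isometries. *)
Record homogeneous_projection : Prop := HomogeneousProjection {
  projection_surj : forall a, exists x, p x = a ;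
  projection_mass : forall A : set X, mass A = sphere_mass (p @^-1` A) ;
  projection_dist : forall (a b : X) (e : R), dist a b < e -> exists x y,
    [/\ p x = a, p y = b & norm2 (val x - val y) < e] ;
  projection_lift : forall x x' y, p x = p x' -> exists2 y',
    p y' = p y & norm2 (val x' - val y') = norm2 (val x - val y) ;
  projection_homogeneous : forall x y, exists f : sphere m r -> sphere m r,
    [/\ forall u v, dot (val (f u)) (val (f v)) = dot (val u) (val v),
        forall u v, p u = p v -> p (f u) = p (f v) &
        p (f x) = p y] }.

Hypothesis projP : homogeneous_projection.

Definition chordal_ball (e : R) (a : X) : set (borel X) := [set b | exists x y,
  [/\ p x = a, p y = b & norm2 (val x - val y) < e]].

Lemma mball_chordal_ball e a : mball a e `<=` chordal_ball e a.
Proof. by move=> b; exact: projection_dist. Qed.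

(** The fibres are translates of one another, so two chords with an endpoint in
    the same fibre can be made to share that endpoint. *)
Lemma chordal_ball_mopen e a : mopen (chordal_ball e a : set X).
Proof.
move=> b [x [y [xa yb xy]]]; exists (e - norm2 (val x - val y)).
  by rewrite subr_gt0.
move=> c /(projection_dist projP)[y' [z [y'b zc y'z]]].
have [x' x'x x'y'] : exists2 x', p x' = p x &
    norm2 (val y' - val x') = norm2 (val y - val x).
  by apply: (projection_lift projP); rewrite yb y'b.
exists x', z; split=> //; first by rewrite x'x.
apply: le_lt_trans (norm2_triangle (val y') _ _) _.
by rewrite norm2_sym x'y' norm2_sym -ltrBrDl.
Qed.

(** An isometry of the sphere that maps the fibre over [a] to the one over [b] and
    descends to [X] maps the preimage of the first ball into that of the second. *)
Lemma mass_chordal_ball e a b : mass (chordal_ball e a) = mass (chordal_ball e b).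
Proof.
rewrite !(projection_mass projP) /sphere_mass; congr (_ * _)%E.
suff le a' b' : (sphere_volume (p @^-1` chordal_ball e a') <=
    sphere_volume (p @^-1` chordal_ball e b'))%E by apply/eqP; rewrite eq_le !le.
have [x xa'] := projection_surj projP a'; have [y yb'] := projection_surj projP b'.
have [f [f_dot f_p fxy]] := projection_homogeneous projP x y.
apply: (@hausdorff_le _ _ _ _ _ f) => [u v|z]; first by rewrite /geodesic_dist f_dot.
move=> [u [v [ua' vz uv]]]; exists (f u), (f v); split; last 1 first.
- by move: uv; rewrite /norm2 !dotE !f_dot.
- by rewrite -yb' -fxy; apply: f_p; rewrite xa'.
- exact: f_p.
Qed.

(** A common point would yield two points of the fibres over [a] and [b] at
    distance less than [2 * e <= r]; but orthogonal points of the sphere have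
    distance [sqrt 2 * r]. *)
Lemma chordal_ball_disjoint e a b : e *+ 2 <= r%:num ->
  (forall u v, p u = a -> p v = b -> dot (val u) (val v) = 0) ->
  chordal_ball e a `&` chordal_ball e b = set0.
Proof.
move=> er ortho; apply/seteqP; split=> // c.
move=> [[x [y [xa yc xy]]] [x' [y' [x'b y'c x'y']]]].
have [z zx' yz] : exists2 z, p z = p x' &
    norm2 (val y - val z) = norm2 (val y' - val x').
  by apply: (projection_lift projP); rewrite yc y'c.
have xz : norm2 (val x - val z) < r%:num.
  apply: lt_le_trans er; apply: le_lt_trans (norm2_triangle (val y) _ _) _.
  by rewrite mulr2n ltrD // yz norm2_sym.
have : norm2 (val x - val z) ^+ 2 < r%:num ^+ 2.
  by rewrite ltr_sqr ?nnegrE ?norm2_ge0.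
have xz0 : dot (val x) (val z) = 0 by apply: ortho => //; rewrite zx'.
rewrite sqr_norm2 !dotE (dotC (val z)) xz0 !dot_sphere.
by have : 0 <= r%:num ^+ 2 :> R by []; lra.
Qed.

(** The chordal balls around the [k + 1] points [p (q i)] are disjoint and of equal
    mass, hence so are their preimages in the unit interval under [phi]. *)
Lemma small_ball k (q : 'I_k.+1 -> sphere m r) (e : R) (phi : R -> X) (a : X) :
    (forall i j u v, i != j -> p u = p (q i) -> p v = p (q j) ->
      dot (val u) (val v) = 0) ->
    e *+ 2 <= r%:num -> is_parameter phi ->
  exists U : set (borel X),
    [/\ measurable U, mball a e `<=` U & (mass U <= (k.+1%:R^-1)%:E)%E].
Proof.
move=> q_ortho er phiP.
have mU b : measurable (chordal_ball e b).
  by apply: measurable_mopen; exact: chordal_ball_mopen.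
exists (chordal_ball e a); split=> //; first exact: mball_chordal_ball.
pose V i : set R := `[0, 1[ `&` phi @^-1` chordal_ball e (p (q i)).
have mV i : measurable (V i) by exact: measurable_parameter.
have V_triv : trivIset setT V.
  apply/trivIsetP => i j _ _ ij; rewrite /V setIACA setIid -preimage_setI.
  rewrite chordal_ball_disjoint ?preimage_set0 ?setI0 // => u v.
  exact: q_ortho ij.
have I1 := @lebesgue_measure_unit_itv R.
have : (lebesgue_measure (\big[setU/set0]_(i < k.+1) V i) <= 1)%E.
  rewrite -I1; apply: le_measure; rewrite ?inE //.
    by apply: bigsetU_measurable => i _; exact: mV.
  apply: (big_ind (fun A => A `<=` _)) => [//|A B AI BI x [/AI|/BI]//|i _ x []//].
rewrite measure_bigsetU_ord //.
rewrite (eq_bigr (fun=> mass (chordal_ball e a))) => [|i _]; last first.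
  by rewrite (mass_chordal_ball e a (p (q i))) -phiP.2.
rewrite sumr_const card_ord => le1.
by rewrite -[(k.+1%:R^-1)%:E]mule1 lee_pdivlMl ?ltr0n // mule_natl.
Qed.

End quotient_of_sphere.

(** * Spheres *)

Section spheres.
Context {R : realType} {n : nat} {r : {posnum R}}.
Implicit Types x y : sphere n r.

Lemma norm2_le_sphere_dist c x y : norm2 (val x - val y) <= sphere_dist c x y.
Proof.
case: c => //=; rewrite /geodesic_dist; set t := _ / _.
have r2 : 0 < r%:num ^+ 2 :> R by [].
have tE : dot (val x) (val y) = r%:num ^+ 2 * t by rewrite mulrC divfK ?gt_eqF.
have t1 : -1 <= t <= 1.
  rewrite -ler_norml normrM normfV (gtr0_norm r2) ler_pdivrMr // mul1r.
  by rewrite (le_trans (dot_le_norm2M _ _)) // (eqP (valP x)) (eqP (valP y)).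
have t0 : 0 <= acos t by rewrite acos_ge0.
(* with [t = cos a], the squared chord is [2 r^2 (1 - cos a) <= (r a)^2] *)
rewrite -ler_sqr ?nnegrE ?norm2_ge0 ?mulr_ge0 // sqr_norm2 !dotE.
rewrite (dotC (val y)) !dot_sphere tE.
have := @cos_ge_quadratic R (acos t); rewrite t0 acos_lepi // acosK ?in_itv //.
move=> /(_ isT) H.
rewrite -subr_ge0.
have : 0 <= r%:num ^+ 2 * (2 * (t - (1 - acos t ^+ 2 / 2))).
  by rewrite !mulr_ge0 // subr_ge0.
by congr (0 <= _); field.
Qed.

Lemma norm2_isometry (g : 'rV[R]_n.+1 -> 'rV[R]_n.+1) x :
  (forall v, dot (g v) (g v) = dot v v) -> norm2 (g (val x)) == r%:num.
Proof. by move=> g_dot; rewrite /norm2 g_dot; exact: (valP x). Qed.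

Definition sphere_map g (g_dot : forall v, dot (g v) (g v) = dot v v) x :
    sphere n r :=
  exist _ (g (val x)) (norm2_isometry x g_dot).

Lemma norm2_basis (i : 'I_n.+1) :
  norm2 (r%:num *: delta_mx 0 i : 'rV[R]_n.+1) == r%:num.
Proof.
rewrite /norm2 /dot (bigD1 i) //= big1 => [|j /negPf ji]; rewrite !mxE eqxx.
  by rewrite eqxx mulr1 addr0 -expr2 sqrtr_sqr gtr0_norm.
by rewrite ji mulr0 mul0r.
Qed.

Definition sphere_basis (i : 'I_n.+1) : sphere n r := 
  exist _ (r%:num *: delta_mx 0 i) (norm2_basis i).

Lemma dot_basis v (i : 'I_n.+1) : dot v (val (sphere_basis i)) = r%:num * v 0 i.
Proof.
rewrite /dot (bigD1 i) //= big1 => [|j /negPf ji]; rewrite !mxE eqxx.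
  by rewrite eqxx mulr1 addr0 mulrC.
by rewrite ji !mulr0.
Qed.

Lemma sphere_projection c :
  homogeneous_projection (id : sphere n r -> sphere_mm c n r).
Proof.
split=> [x|A|x y e xy|x x' y ->|x y].
- by exists x.
- by [].
- by exists x, y; split=> //; exact: le_lt_trans (norm2_le_sphere_dist c x y) xy.
- by exists y.
- exists (sphere_map (fun v => dot_reflection (val x - val y) v v)).
  split=> [u v|u v ->//|]; first exact: dot_reflection.
  by apply/val_inj/reflection_swap; rewrite !dot_sphere.
Qed.

Lemma sphere_small_ball c (e : R) (phi : R -> sphere_mm c n r)
    (a : sphere_mm c n r) :
    e *+ 2 <= r%:num -> is_parameter phi ->
  exists U : set (borel (sphere_mm c n r)),
    [/\ measurable U, mball a e `<=` U & (mass U <= (n.+1%:R^-1)%:E)%E].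
Proof.
apply: (small_ball (sphere_projection c) (q := sphere_basis)) => i j _ _ ij -> ->.
by rewrite dot_basis !mxE eqxx eq_sym (negPf ij) !mulr0.
Qed.

End spheres.

(** * Complex structure and unitary reflections *)

Section complex_structure.
Context {R : realType} {m : nat}.
Implicit Types (x y w : 'rV[R]_(m + m)) (a b t : R).

(** Multiplication by the imaginary unit. *)
Definition rot x : 'rV[R]_(m + m) := row_mx (- rsubmx x) (lsubmx x).

Lemma hopfE t x : hopf t x = cos t *: x + sin t *: rot x.
Proof.
rewrite -{2}(hsubmxK x) /hopf /rot !scale_row_mx add_row_mx.
by rewrite scalerN [sin t *: lsubmx x + _]addrC.
Qed.

Lemma rotZD a b x y : rot (a *: x + b *: y) = a *: rot x + b *: rot y.
Proof.
by rewrite /rot !linearD !linearZ /= !scale_row_mx add_row_mx.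
Qed.

Lemma rotK x : rot (rot x) = - x.
Proof. by rewrite /rot row_mxKl row_mxKr -{3}(hsubmxK x) opp_row_mx. Qed.

Lemma dot_rot x y : dot (rot x) (rot y) = dot x y.
Proof.
rewrite -{2}(hsubmxK x) -{2}(hsubmxK y) /dot !big_split_ord /= addrC.
by congr (_ + _); apply: eq_bigr => i _; rewrite ?row_mxEl ?row_mxEr // !mxE mulrNN.
Qed.

Lemma dot_rotl x y : dot (rot x) y = - dot x (rot y).
Proof. by rewrite -dot_rot rotK dotNl. Qed.

Lemma dot_rot_self x : dot (rot x) x = 0.
Proof. by have := dot_rotl x x; rewrite (dotC x); lra. Qed.

Lemma dot_hopf t x y : dot (hopf t x) (hopf t y) = dot x y.
Proof.
rewrite !hopfE !dotE dot_rot dot_rotl -[RHS]mul1r -(cos2Dsin2 t); ring.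
Qed.

Lemma rot_reflection w x : rot (reflection w x) = reflection (rot w) (rot x).
Proof.
rewrite /reflection !dot_rot -{1}(scale1r x) -scaleNr rotZD scale1r.
by rewrite scaleNr.
Qed.

(** For [w != 0], the product of the commuting real reflections along [w] and [i w]
    is minus the identity on the complex line of [w] and the identity on its complex
    orthogonal complement. *)
Definition unitary_reflection w x := reflection w (reflection (rot w) x).

Lemma reflectionZD w a b x y :
  reflection w (a *: x + b *: y) = a *: reflection w x + b *: reflection w y.
Proof.
rewrite /reflection !dotE !scalerBr !scalerA addrACA -opprD -scalerDl.
by congr (_ - _ *: _); ring.
Qed.

Lemma dot_unitary_reflection w x y :
  dot (unitary_reflection w x) (unitary_reflection w y) = dot x y.
Proof. by rewrite !dot_reflection. Qed.

(** Multiplication by [i] exchanges the two reflections, up to the sign of [w]. *)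
Lemma rot_unitary_reflection w x :
  rot (unitary_reflection w x) = unitary_reflection w (rot x).
Proof.
rewrite /unitary_reflection !rot_reflection rotK reflectionN.
by rewrite reflectionC // dot_rot_self.
Qed.

Lemma unitary_reflection_hopf w t x :
  unitary_reflection w (hopf t x) = hopf t (unitary_reflection w x).
Proof.
by rewrite !hopfE rot_unitary_reflection /unitary_reflection !reflectionZD.
Qed.

(** If the Hermitian product of [x] and [y] is real, then [x] is orthogonal to
    [i (x - y)] and fixed by the first reflection; the second maps it to [y]. *)
Lemma unitary_reflection_swap x y : dot x x = dot y y -> dot x (rot y) = 0 ->
  unitary_reflection (x - y) x = y.
Proof.
move=> xy xry; rewrite /unitary_reflection.
rewrite (@reflection_orthogonal _ _ (rot _)); last first.
  have -> : x - y = 1 *: x + (-1) *: y by rewrite scale1r scaleN1r.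
  by rewrite rotZD !dotE xry (dotC x (rot x)) dot_rot_self !mulr0 addr0.
exact: reflection_swap.
Qed.

(** The imaginary part of the Hermitian product of [x] and [e^(it) y] changes its
    sign between [t = 0] and [t = pi], and so vanishes in between. *)
Lemma hopf_phase x y : exists t, dot x (rot (hopf t y)) = 0.
Proof.
pose g t := cos t * dot x (rot y) - sin t * dot x y.
have gc : continuous g.
  move=> t; apply: cvgB; apply: cvgMr_tmp.
    exact: continuous_cos.
  exact: continuous_sin.
have [||t _ gt] := @IVT R g 0 pi 0 (pi_ge0 R).
- exact: continuous_subspaceT.
- rewrite /g cos0 sin0 cospi sinpi !mul0r !subr0 mul1r mulN1r.
  by rewrite ge_min le_max oppr_ge0 oppr_le0 !le_total.
by exists t; rewrite hopfE rotZD rotK !dotE mulrN.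
Qed.

End complex_structure.

(** * Complex projective spaces *)

Section complex_projective_spaces.
Context {R : realType} {n : nat} {r : {posnum R}}.
Local Notation S := (sphere (n + n.+1) r).

Definition hopf_action t : S -> S :=
  sphere_map (fun v => @dot_hopf R n.+1 t v v).

Definition sphere_unitary_reflection w : S -> S :=
  sphere_map (fun v => @dot_unitary_reflection R n.+1 w v v).

Lemma dot_hopf_action t (x y : S) :
  dot (val (hopf_action t x)) (val (hopf_action t y)) = dot (val x) (val y).
Proof. exact: (@dot_hopf R n.+1). Qed.

Lemma hopf_projP (x y : S) :
  hopf_proj x = hopf_proj y <-> exists t, y = hopf_action t x.
Proof.
split=> [/eqmodP/asboolP[t yx]|[t ->]]; first by exists t; exact: val_inj.
by apply/eqmodP/asboolP; exists t.
Qed.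

Lemma hopf_proj_surj (a : cproj n r) : exists x : S, hopf_proj x = a.
Proof. by exists (repr a); exact: reprK. Qed.

Lemma hopf_proj_action t (x : S) : hopf_proj (hopf_action t x) = hopf_proj x.
Proof. by apply/esym/hopf_projP; exists t. Qed.

Lemma cproj_projection c :
  homogeneous_projection (@hopf_proj R n r : S -> cproj_mm c n r).
Proof.
split=> [a|A|a b e ab|x x' y /hopf_projP[t ->]|x y].
- exact: hopf_proj_surj.
- by [].
- have [x xa] := hopf_proj_surj a; have [y yb] := hopf_proj_surj b.
  have [|_ [x' x'a] [y' y'b] <- x'y'] := inf_lt _ ab.
    by exists (sphere_dist c x y), x => //; exists y.
  exists x', y'; split=> //.
  exact: le_lt_trans (norm2_le_sphere_dist c x' y') x'y'.
- exists (hopf_action t y); first exact: hopf_proj_action.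
  by rewrite /norm2 !dotE !dot_hopf_action.
- have [t xty] := @hopf_phase R n.+1 (val x) (val y).
  exists (sphere_unitary_reflection (val x - val (hopf_action t y))).
  split=> [u v|u v /hopf_projP[s ->]|].
  + exact: (@dot_unitary_reflection R n.+1).
  + apply/hopf_projP; exists s; apply: val_inj.
    exact: (@unitary_reflection_hopf R n.+1).
  + rewrite -(hopf_proj_action t y); congr hopf_proj; apply: val_inj.
    apply: (@unitary_reflection_swap R n.+1) => //.
    by rewrite !dot_sphere.
Qed.

Definition cproj_basis (i : 'I_n.+1) : S := sphere_basis (lshift n.+1 i).

Lemma cproj_small_ball c (e : R) (phi : R -> cproj_mm c n r)
    (a : cproj_mm c n r) :
    e *+ 2 <= r%:num -> is_parameter phi ->
  exists U : set (borel (cproj_mm c n r)),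
    [/\ measurable U, mball a e `<=` U & (mass U <= (n.+1%:R^-1)%:E)%E].
Proof.
apply: (small_ball (cproj_projection c) (q := cproj_basis)) => i j u v ij.
move=> /esym/hopf_projP[s ->] /esym/hopf_projP[t ->].
(* only the difference of the two phases matters *)
have -> : hopf_action s (cproj_basis i) =
    hopf_action t (hopf_action (s - t) (cproj_basis i)).
  by apply: val_inj; rewrite /= hopfD addrC subrK.
rewrite dot_hopf_action dot_basis.
have -> : val (hopf_action (s - t) (cproj_basis i)) 0 (lshift n.+1 j) = 0.
  (* neither [e_i] nor [i e_i] has a component along [e_j] *)
  rewrite [LHS]row_mxEl !mxE -!val_eqE /= val_eqE eq_sym (negPf ij).
  by rewrite gtn_eqF ?ltn_addr ?ltn_ord //= !mulr0 subrr.
by rewrite mulr0.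
Qed.

End complex_projective_spaces.

(** * No box-convergent subsequence *)

Theorem proposition7p4 (R : realType) (c : sphere_distance)
    (r : nat -> {posnum R})
    (r_inf : 0 < inf [set (r n)%:num | n in [set n | (0 < n)%N]]) :
  ~ has_box_convergent_subsequence
      (fun n => sphere_mm c n.+1 (r n.+1)) /\
  ~ has_box_convergent_subsequence
      (fun n => cproj_mm c n.+1 (r n.+1)).
Proof.
set e := inf _ in r_inf.
have er n : (e / 2) *+ 2 <= (r n.+1)%:num.
  rewrite -mulr_natr divfK ?pnatr_eq0 //; apply: ge_inf; last by exists n.+1.
  by exists 0 => _ [k _ <-].
have e0 : 0 < e / 2 by rewrite divr_gt0.
have weaken n : (((n.+2)%:R^-1)%:E <= ((n.+1)%:R^-1)%:E :> \bar R)%E.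
  by rewrite lee_fin lef_pV2 ?posrE ?ltr0n // ler_nat.
split; apply: (no_box_convergent_subsequence e0) => n phi phiP a.
- have [U [mU aU /le_trans/(_ (weaken n)) Un]] := sphere_small_ball a (er n) phiP.
  by exists U.
- have [U [mU aU /le_trans/(_ (weaken n)) Un]] := cproj_small_ball a (er n) phiP.
  by exists U.
Qed.
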